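(* Let $T$ be a complete theory with monster model $\mathfrak{C}$, let $\varphi(\overline{x};\overline{y})$ be a partitioned formula, and let $N$ be a positive integer such that for every $B\subseteq\mathfrak{C}^{\mathrm{lg}(\overline{y})}$ with $|B|=N$ we have $|S_\varphi(B)|\le\frac{N(N+1)}{2}$. Then $\varphi$ has UDTFS.
   Context: Formulas are $\emptyset$-definable. For $B \subseteq \mathfrak{C}^{\mathrm{lg}(\overline{y})}$, $S_\varphi(B)$ is the set of $\varphi$-types over $B$: maximal consistent sets of formulas $\varphi(\overline{x};\overline{b})$ or $\neg\varphi(\overline{x};\overline{b})$ with $\overline{b}\in B$. A formula $\psi(\overline{y})$ (possibly with parameters) defines $p\in S_\varphi(B)$ if for all $\overline{b}\in B$, $\models\psi(\overline{b})$ iff $\varphi(\overline{x};\overline{b})\in p$. $\varphi(\overline{x};\overline{y})$ has UDTFS if there is a formula $\psi(\overline{y}; \overline{z}_0,\dots,\overline{z}_{k-1})$ such that for every finite set $B$ of $\mathrm{lg}(\overline{y})$-tuples with $|B|\ge 2$ and every $p\in S_\varphi(B)$ there are $\overline{c}_0,\dots,\overline{c}_{k-1}\in B$ such that $\psi(\overline{y};\overline{c}_0,\dots,\overline{c}_{k-1})$ defines $p$. *)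

(* Defs.v *)
Set Warnings "-notation-overridden,-notation-incompatible-prefix".
From mathcomp Require Export all_boot.
From mathcomp Require Export boolp classical_sets functions cardinality.

Set Implicit Arguments.
Unset Strict Implicit.
Unset Printing Implicit Defensive.

Local Open Scope classical_set_scope.
Local Open Scope card_scope.

Record language := Language {
  funsym : nat -> Type;
  relsym : nat -> Type
}.

(* [formula L V] is the type of formulas whose free variables lie in [V]. A
   quantifier binds the variable [None] of a formula over [option V]. *)
Inductive term (L : language) (V : Type) : Type :=
| Var of V
| App (r : nat) of funsym L r & 'I_r -> term L V.

Inductive formula (L : language) (V : Type) : Type :=
| Eq of term L V & term L V
| Rel (r : nat) of relsym L r & 'I_r -> term L V
| Not of formula L V
| And of formula L V & formula L V
| Ex of formula L (option V).

Notation sentence L := (formula L void).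

Fixpoint rename_term L (V W : Type) (s : V -> W) (t : term L V) : term L W :=
  match t with
  | Var x => Var L (s x)
  | App r f ts => App f (fun i => rename_term s (ts i))
  end.

Fixpoint rename L (V W : Type) (s : V -> W) (chi : formula L V) :
    formula L W :=
  match chi with
  | Eq t u => Eq (rename_term s t) (rename_term s u)
  | Rel r R ts => Rel R (fun i => rename_term s (ts i))
  | Not c => Not (rename s c)
  | And c d => And (rename s c) (rename s d)
  | Ex c => Ex (rename (omap s) c)
  end.

Record structure (L : language) := Structure {
  carrier :> Type;
  carrier_inhabited : inhabited carrier;
  func_interp : forall r, funsym L r -> r.-tuple carrier -> carrier;
  rel_interp : forall r, relsym L r -> r.-tuple carrier -> Prop
}.

Fixpoint eval L (M : structure L) (V : Type) (v : V -> M) (t : term L V) : M :=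
  match t with
  | Var x => v x
  | App r f ts => func_interp f [tuple eval v (ts i) | i < r]
  end.

Fixpoint sat L (M : structure L) (V : Type) (chi : formula L V)
    (v : V -> M) : Prop :=
  match chi with
  | Eq t u => eval v t = eval v u
  | Rel r R ts => rel_interp R [tuple eval v (ts i) | i < r]
  | Not c => ~ sat c v
  | And c d => sat c v /\ sat d v
  | Ex c => exists a : M, sat c (oapp v a)
  end.

Definition holds L (M : structure L) (s : sentence L) : Prop :=
  sat (M := M) s (of_void M).

Definition models L (M : structure L) (T : set (sentence L)) : Prop :=
  forall s, T s -> holds M s.

Definition entails L (T : set (sentence L)) (s : sentence L) : Prop :=
  forall M : structure L, models M T -> holds M s.

Definition complete_theory L (T : set (sentence L)) : Prop :=
  (exists M : structure L, models M T) /\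
  forall s, entails T s \/ entails T (Not s).

Definition elementary_embedding L (M D : structure L) (e : M -> D) : Prop :=
  forall (r : nat) (chi : formula L 'I_r) (v : 'I_r -> M),
    sat chi v <-> sat chi (e \o v).

Definition join (V W X : Type) (u : V -> X) (v : W -> X) (s : V + W) : X :=
  match s with inl x => u x | inr y => v y end.

(* An element of [formula L (V + M)] is a formula with variables in [V] and
   parameters in [M]. [inst theta b] is theta(x; b), which has the parameters
   [b] in place of the variables [W]. *)
Definition inst L (M : structure L) (V W : Type)
    (theta : formula L (V + W)) (b : W -> M) : formula L (V + M) :=
  rename (join inl (inr \o b)) theta.

Definition over L (M : structure L) (V : Type) (A : set M) :
    set (formula L (V + M)) :=
  [set chi | exists (r : nat) (theta : formula L (V + 'I_r)) (a : 'I_r -> M),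
     (forall i, A (a i)) /\ chi = inst theta a].

(* Consistency with the elementary diagram of [M] *)
Definition consistent L (M : structure L) (V : Type)
    (p : set (formula L (V + M))) : Prop :=
  exists (D : structure L) (e : M -> D) (a : V -> D),
    elementary_embedding e /\ forall chi, p chi -> sat chi (join a e).

Definition realized L (M : structure L) (V : Type)
    (p : set (formula L (V + M))) : Prop :=
  exists a : V -> M, forall chi, p chi -> sat chi (join a id).

(* The type [kappa] stands for its cardinality: [A] is small if |A| < kappa. *)
Definition small (kappa X : Type) (A : set X) : Prop :=
  ~ ([set: kappa] #<= A).

Definition saturated L (kappa : Type) (M : structure L) : Prop :=
  forall A : set M, small kappa A ->
  forall p : set (formula L (unit + M)),
    p `<=` over A -> consistent p -> realized p.

Definition automorphism L (M : structure L) (g : M -> M) : Prop :=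
  [/\ bijective g,
      forall r (f : funsym L r) (a : r.-tuple M),
        g (func_interp f a) = func_interp f (map_tuple g a)
    & forall r (R : relsym L r) (a : r.-tuple M),
        rel_interp R a <-> rel_interp R (map_tuple g a)].

Definition elementary_on L (M : structure L) (A : set M) (f : M -> M) : Prop :=
  forall (r : nat) (chi : formula L 'I_r) (v : 'I_r -> M),
    (forall i, A (v i)) -> (sat chi v <-> sat chi (f \o v)).

Definition strongly_homogeneous L (kappa : Type) (M : structure L) : Prop :=
  forall A : set M, small kappa A ->
  forall f : M -> M, elementary_on A f ->
  exists g : M -> M, automorphism g /\ forall a, A a -> g a = f a.

(* The number of sentences is |L| + aleph_0, so the second condition is
   kappa > |L| + aleph_0. *)
Definition monster_model L (kappa : Type) (T : set (sentence L))
    (C : structure L) : Prop :=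
  [/\ models C T, small kappa [set: sentence L],
      saturated kappa C & strongly_homogeneous kappa C].

Section PhiTypes.
Variables (L : language) (C : structure L) (m n : nat).
Variable phi : formula L ('I_m + 'I_n).

Definition phi_at (b : n.-tuple C) : formula L ('I_m + C) := inst phi (tnth b).

Definition phi_formulas (B : set (n.-tuple C)) : set (formula L ('I_m + C)) :=
  [set chi | exists b, B b /\ (chi = phi_at b \/ chi = Not (phi_at b))].

Definition phi_types (B : set (n.-tuple C)) :
    set (set (formula L ('I_m + C))) :=
  [set p | [/\ p `<=` phi_formulas B, consistent p &
     forall q, q `<=` phi_formulas B -> consistent q -> p `<=` q -> q = p]].

(* In psi(y; z_0, ..., z_(k-1)) the variables y are indexed by ['I_n], and the
   variable (j, i) is the i-th entry of z_j. *)
Definition defines k (psi : formula L ('I_n + 'I_k * 'I_n))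
    (c : 'I_k -> n.-tuple C) (B : set (n.-tuple C))
    (p : set (formula L ('I_m + C))) : Prop :=
  forall b, B b ->
    (sat psi (join (tnth b) (fun z => tnth (c z.1) z.2)) <-> p (phi_at b)).

Definition UDTFS : Prop :=
  exists (k : nat) (psi : formula L ('I_n + 'I_k * 'I_n)),
  forall B : set (n.-tuple C), finite_set B -> `I_2 #<= B ->
  forall p, phi_types B p ->
  exists c : 'I_k -> n.-tuple C, (forall j, B (c j)) /\ defines psi c B p.

End PhiTypes.

(* Main.v *)
(* Fix a finite B and a type p over B, and encode every type over B by the set of
   its disagreements with p ("flips"). If two elements of B have the same profile
   over a set Y (the same patterns over Y are consistent with phi and with ~phi
   at them) but opposite truth values in p, then their flips are forced in
   opposite ways by every pattern of flips on Y: they are antitwins over Y. A set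
   Y of bounded size without antitwins therefore defines p: the truth value at y
   is a function of the profile of y over Y, and this function is coded by
   equalities between two distinct elements of B.

   Suppose that there is no such Y. A set Y of given size whose vanishing
   constrains the flips as much as possible is exchange-robust: adding a few
   antitwins z leaves most elements c of Y free to be the only flip. If c can
   flip without z, then z is not forced by the pattern {c}, hence neither is its
   antitwin y, and {c, y} is a possible pattern as well. Iterating gives
   c_1, ..., c_N such that each c_j can be the only flip and such that, for i < j,
   the first two flips can be c_i and c_j. These are 1 + N + N (N - 1) / 2
   different types over N elements, one more than N (N + 1) / 2. *)
Require Import Defs.
Set Implicit Arguments.
Unset Strict Implicit.
Unset Printing Implicit Defensive.

Local Open Scope nat_scope.

(** * Antitwins and good sequences in a family of finite sets *)

Section Flips.
Import mathcomp.boot.fintype mathcomp.boot.finset.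
Variables (T : finType) (F : {set {set T}}).
Implicit Types (V W Y Z J R S f : {set T}) (c y z : T).

Definition antitwins Y y z : Prop := forall (h : {set T}) (e : bool),
  (exists2 f, f \in F & f :&: Y = h /\ (y \in f) = e) <->
  (exists2 f, f \in F & f :&: Y = h /\ (z \in f) = ~~ e).

Definition single c W : Prop := exists2 f, f \in F & f :&: (c |: W) = [set c].

(* The entries are pairs (c_j, z_j) of antitwins over V and the earlier c_i; only
   the c_j are part of the sequence, the z_j witness that they are antitwins. *)
Fixpoint good V (s : seq (T * T)) : Prop :=
  if s is (c, z) :: s' then
    [/\ antitwins V c z, single c (V :|: [set x in unzip1 s']),
        forall j, j < size s' -> exists2 f, f \in F &
          nth c (unzip1 s') j \in f /\
          f :&: (c |: (V :|: [set x in take j (unzip1 s')])) = [set c]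
      & good (c |: V) s']
  else True.

(** In the clause for pairs the entries after [j] are unconstrained: [i] and [j] are only the first
    two flips. *)
Definition triangular (s : seq T) : Prop :=
  (forall x0 i, i < size s -> exists2 f, f \in F &
     forall k, k < size s -> (nth x0 s k \in f) = (k == i)) /\
  (forall x0 i j, i < j < size s -> exists2 f, f \in F &
     forall k, k <= j -> (nth x0 s k \in f) = (k == i) || (k == j)).

Lemma antitwins_sym Y y z : antitwins Y y z -> antitwins Y z y.
Proof.
by move=> h g e; have := h g (~~ e); rewrite negbK => h'; apply: iff_sym.
Qed.

Lemma antitwins_sub Y W y z : Y \subset W -> antitwins W y z -> antitwins Y y z.
Proof.
move=> sYW tw h e; split=> -[f Ff [fY fe]].
  have [|g Fg [gW ge]] := (tw (f :&: W) e).1; first by exists f.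
  exists g => //; split=> //.
  by rewrite -fY -(setIidPr sYW) !setIA gW.
have [|g Fg [gW ge]] := (tw (f :&: W) e).2; first by exists f.
exists g => //; split=> //.
by rewrite -fY -(setIidPr sYW) !setIA gW.
Qed.

Lemma antitwins_flip Y y z f : antitwins Y y z -> f \in F -> z \notin f ->
  exists2 g, g \in F & g :&: Y = f :&: Y /\ y \in g.
Proof. by move=> tw Ff /negbTE zf; apply: (tw (f :&: Y) true).2; exists f. Qed.

Hypothesis F0 : set0 \in F.

Lemma antitwins_open Y y z : antitwins Y y z ->
  exists2 f, f \in F & f :&: Y = set0 /\ y \in f.
Proof.
move=> tw; have [|g Fg []] := antitwins_flip tw F0; first by rewrite inE.
by rewrite set0I => ? ?; exists g.
Qed.

Lemma antitwins_notin Y y z : antitwins Y y z -> y \notin Y.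
Proof.
move=> /antitwins_open [f _ [f0 yf]]; apply/negP => yY.
by have := in_set0 y; rewrite -f0 inE yf yY.
Qed.

Lemma single_sub c V W : V \subset W -> single c W -> single c V.
Proof.
move=> sVW [f Ff fc]; exists f => //; apply/setP=> x; move/setP: fc => /(_ x).
rewrite !inE; case: eqP => //= _; case xV: (x \in V); last by rewrite andbF.
by rewrite (subsetP sVW _ xV).
Qed.

Lemma good_sub V W s : V \subset W -> good W s -> good V s.
Proof.
elim: s V W => // -[c z] s IHs V W sVW [tw sg pr gs]; split.
- exact: antitwins_sub tw.
- by apply: single_sub sg; apply: setSU.
- move=> j /pr [f Ff [sf fc]]; exists f => //; split=> //.
  apply/setP=> x; move/setP: fc => /(_ x); rewrite !inE; case: eqP => //= _.
  case: (x \in take _ _); first by rewrite !orbT.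
  case xV: (x \in V); last by rewrite !andbF.
  by rewrite (subsetP sVW _ xV).
- by apply: IHs gs; apply: setUS.
Qed.

Lemma good_antitwins V s j x0 : good V s -> j < size s ->
  antitwins (V :|: [set x in take j (unzip1 s)])
    (nth x0 (unzip1 s) j) (nth x0 (unzip2 s) j).
Proof.
elim: s V j => // -[c z] s IHs V [|j] /= [tw _ _ gs] js.
  by apply: antitwins_sub tw; apply/subsetP=> x; rewrite !inE orbF.
apply: antitwins_sub (IHs _ j gs js).
by apply/subsetP=> x; rewrite !inE; case/orP=> [->|/orP[->|->]]; rewrite ?orbT.
Qed.

(** The tail is good over [c |: V], so its members miss [c] and serve the indices without the head;
    the clauses at the head serve the others. *)
Lemma good_triangular V s : good V s -> triangular (unzip1 s).
Proof.
(* Disjointness from [V] is added for the induction, where [V] absorbs the earlier entries. *)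
move=> gs; suff [H1 H2]:
  (forall x0 i, i < size (unzip1 s) -> exists2 f, f \in F &
     f :&: V = set0 /\
     forall k, k < size (unzip1 s) -> (nth x0 (unzip1 s) k \in f) = (k == i)) /\
  (forall x0 i j, i < j < size (unzip1 s) -> exists2 f, f \in F &
     f :&: V = set0 /\
     forall k, k <= j -> (nth x0 (unzip1 s) k \in f) = (k == i) || (k == j)).
  split=> [x0 i hi | x0 i j hij].
    by have [f Ff [_ hf]] := H1 x0 i hi; exists f.
  by have [f Ff [_ hf]] := H2 x0 i j hij; exists f.
elim: s V gs => [|[c z] s IHs] V /=; first by split=> // ? ? ?; rewrite andbF.
case=> tw [g Fg gc] pr gs; have [H1 H2] := IHs _ gs.
have cV := antitwins_notin tw.
(* Each later entry has an antitwin over a set containing [c], hence lies outside that set. *)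
have cs : c \notin unzip1 s.
  apply/negP=> /(nthP c)[j]; rewrite size_map => js jc.
  by have /antitwins_notin := good_antitwins c gs js; rewrite jc !inE eqxx.
have avoid f : f :&: (c |: V) = set0 -> f :&: V = set0 /\ c \notin f.
  move/setP=> h; split.
    by apply/setP=> x; have := h x; rewrite !inE; case: (x \in V); rewrite ?orbT ?andbF.
  by have := h c; rewrite !inE eqxx andbT => ->.
have only f W : f :&: (c |: W) = [set c] ->
    c \in f /\ forall x, x \in W -> x != c -> x \notin f.
  move/setP=> h; split; first by have := h c; rewrite !inE eqxx andbT.
  move=> x xW xc; have := h x; rewrite !inE xW orbT andbT (negbTE xc) => ->; by [].
have neqc k : k < size (unzip1 s) -> forall x0, nth x0 (unzip1 s) k != c.
  by move=> ks x0; apply: contraNneq cs => <-; rewrite mem_nth.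
have VIE f : (forall x, x \in V -> x != c -> x \notin f) -> f :&: V = set0.
  move=> h; apply/setP=> x; rewrite !inE; case xV: (x \in V); last by rewrite andbF.
  rewrite andbT; apply/negbTE/h => //; by apply: contraNneq cV => <-.
split=> x0.
  case=> [_|i hi].
    exists g => //; have [cg h] := only _ _ gc; split.
      by apply: VIE => x xV; apply: h; rewrite inE xV.
    case=> [|k] //= ks; apply/negbTE/h; last exact: neqc.
    by rewrite !inE mem_nth ?orbT.
  have [f Ff [/avoid[fV cf] hf]] := H1 x0 i hi; exists f => //; split=> //.
  by case=> [|k] //= ks; [apply/negbTE | rewrite hf].
case=> [|i] [|j] //= hj.
  have [|f Ff [jf fc]] := pr j; first by rewrite -(size_map fst).
  exists f => //; have [cf h] := only _ _ fc; split.
    by apply: VIE => x xV; apply: h; rewrite inE xV.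
  case=> [|k] //=; rewrite ltnS => kj.
  have ks : k < size (unzip1 s) by apply: leq_ltn_trans kj _.
  rewrite eqSS; case: eqP => [->|/eqP nkj]; first by rewrite (set_nth_default c).
  have {nkj}kj : k < j by rewrite ltn_neqAle nkj.
  apply/negbTE/h; last exact: neqc.
  rewrite !inE; apply/orP; right; rewrite -(nth_take _ kj) mem_nth // size_take.
  by case: ifP.
have [f Ff [/avoid[fV cf] hf]] := H2 x0 i j hj; exists f => //; split=> //.
by case=> [|k] //= ks; [apply/negbTE | rewrite hf].
Qed.

(** * Exchange in sets with the fewest vanishing members *)

Definition vanishing V := [set f in F | [disjoint f & V]].

(** Trading [S] for [Z] respects the bound [K]. Members vanishing on the new set vanish on the old
    one, and [f] would vanish on the old one only, against minimality. *)
Lemma minimal_swap V R Y S Z (K : nat) y f :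
  (forall Y' : {set T}, Y' \subset R -> #|Y'| <= K ->
     #|vanishing (V :|: Y)| <= #|vanishing (V :|: Y')|) ->
  Y \subset R -> S \subset Y -> Z \subset R -> #|Y :\: S| + #|Z| <= K ->
  (forall g, g \in F -> [disjoint g & V :|: ((Y :\: S) :|: Z)] ->
     [disjoint g & S]) ->
  y \in Z -> f \in F -> y \in f -> ~ [disjoint f & V :|: Y].
Proof.
move=> min YR SY ZR cK forced yZ Ff yf dis.
have /min : (Y :\: S) :|: Z \subset R.
  by rewrite subUset ZR andbT (subset_trans (subsetDl _ _)).
have le : #|(Y :\: S) :|: Z| <= K.
  by apply: leq_trans cK; rewrite cardsU leq_subr.
move/(_ le); rewrite leqNgt => /negP; apply; apply: proper_card.
apply/properP; split.
  apply/subsetP=> g; rewrite !inE => /andP[Fg dg]; rewrite Fg /=.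
  have dS := forced g Fg dg; rewrite -setI_eq0 -subset0; apply/subsetP=> x.
  rewrite !inE => /andP[xg xVY]; move: dg dS.
  rewrite -!setI_eq0 => /eqP/setP/(_ x) + /eqP/setP/(_ x); rewrite !inE xg /=.
  by move: xVY => /orP[->//|->] h1 h2; move: h1; rewrite h2 orbT.
exists f; first by rewrite !inE Ff dis.
rewrite !inE Ff /= -setI_eq0; apply/negP=> /eqP/setP/(_ y).
by rewrite !inE yf yZ !orbT.
Qed.

(** Otherwise the exceptional points could be traded for [Z]: a member vanishing after the trade but
    containing an exceptional [c] meets [Y] inside [J], hence only in [c], and so witnesses [single]
    for [c]. *)
Lemma few_forced V R Y J Z (K : nat) y f :
  (forall Y' : {set T}, Y' \subset R -> #|Y'| <= K ->
     #|vanishing (V :|: Y)| <= #|vanishing (V :|: Y')|) ->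
  Y \subset R -> #|Y| <= K -> J \subset Y -> Z \subset R ->
  (forall g, g \in F -> [disjoint g & V] -> g :&: Y \subset J ->
     #|g :&: J| <= 1) ->
  y \in Z -> f \in F -> y \in f -> [disjoint f & V :|: Y] ->
  #|[set c in J | ~~ `[<single c (V :|: Y :|: Z)>]]| < #|Z|.
Proof.
move=> min YR YK JY ZR indep yZ Ff yf dis; rewrite ltnNge; apply/negP=> le.
set S := [set c in J | _] in le.
have SJ : S \subset J by apply/subsetP=> x; rewrite inE => /andP[].
have SY := subset_trans SJ JY.
apply: (@minimal_swap V R Y S Z K y f) => //.
  rewrite cardsD (setIidPr SY); apply: leq_trans YK.
  by rewrite -[leqRHS](subnK (subset_leq_card SY)) leq_add2l.
move=> g Fg; rewrite -!setI_eq0 => /eqP/setP dg; apply/eqP/setP=> c; rewrite [RHS]inE.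
apply/negbTE/negP; rewrite inE => /andP[cg cS].
have cJ := subsetP SJ _ cS.
have gV : [disjoint g & V].
  rewrite -setI_eq0; apply/eqP/setP=> x; move: (dg x); rewrite !inE.
  by case: (x \in V); rewrite ?orbT ?andbT ?andbF.
have gYS x : x \in g -> x \in Y -> x \in S.
  move=> xg xY; have [//|xS] := boolP (x \in S); move: (dg x).
  by rewrite in_set0 in_setI xg !in_setU in_setD xS xY orbT.
have gYJ : g :&: Y \subset J.
  by apply/subsetP=> x /setIP[xg xY]; apply: (subsetP SJ); apply: gYS.
move: cS; rewrite inE cJ /= => /asboolP; apply; exists g => //.
apply/setP=> x; rewrite [RHS]inE; case: eqP => [->|/eqP xc].
  by rewrite !inE cg eqxx.
apply/negbTE/negP=> /setIP[xg xW].
have gJc : #|g :&: J| <= 1 by apply: indep.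
have xJ : x \in J.
  apply: (subsetP SJ); apply: gYS => //.
  move: xW (dg x); rewrite !inE (negbTE xc) xg /= => /orP[/orP[->//|->//]|->].
  by rewrite !orbT.
have := card_le1_eqP gJc c x; rewrite !inE cg cJ xg xJ => /(_ isT isT) E.
by rewrite E eqxx in xc.
Qed.

End Flips.

(** * Ramsey-type dichotomy and bounded antitwin-free sets *)

Section Blocks.
Import mathcomp.boot.fintype mathcomp.boot.finset.

Lemma pigeonhole_set (T U : finType) (D : {set T}) (P : {set U}) (g : T -> U) (k : nat) :
  (forall x, x \in D -> g x \in P) -> #|P| * k < #|D| ->
  exists2 u, u \in P & k < #|[set x in D | g x == u]|.
Proof.
move=> gP lt; apply/exists_inP; apply: contraLR lt => /exists_inPn h.
rewrite -leqNgt -sum1_card (partition_big g (mem P)) //= -sum_nat_const.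
apply: leq_sum => u /h; rewrite -leqNgt; apply: leq_trans.
by rewrite -sum1_card; apply: eq_leq; apply: eq_bigl => x; rewrite !inE.
Qed.

(** Ramsey argument by induction on [r]. If a largest independent [J] is too small, every point
    outside has an edge in its union with [J]; many such edges share one trace on [J], and a point
    of this trace starts the sequence. *)
Lemma independent_or_pairs (j r : nat) : exists K : nat,
  forall (T : finType) (E : {set {set T}}) (Y : {set T}), K <= #|Y| ->
  (exists2 J : {set T}, J \subset Y &
     j <= #|J| /\ forall e, e \in E -> e \subset J -> #|e| <= 1) \/
  (exists s : seq T, [/\ size s = r, uniq s, {subset s <= Y} &
     forall x0 i k, i < k < size s -> exists2 e, e \in E & e \subset Y /\
       forall l, l < size s -> (nth x0 s l \in e) = (l == i) || (l == k)]).
Proof.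
elim: r => [|r [K IH]].
  by exists 0 => T E Y _; right; exists [::]; split=> // x0 i k; rewrite ltn0 andbF.
(* The first summand exceeds the size of [J]; the second leaves more than [K] points for one of the
   at most [2 ^ j] traces on [J]. *)
exists (j + 2 ^ j * K) => T E Y leY.
pose indep (J : {set T}) := [forall e in E, (e \subset J) ==> (#|e| <= 1)].
have indepP (J : {set T}) :
    reflect (forall e : {set T}, e \in E -> e \subset J -> #|e| <= 1) (indep J).
  by apply: (iffP forall_inP) => h e Ee; apply/implyP; apply: h.
have: [exists J : {set T}, (J \subset Y) && indep J].
  apply/existsP; exists set0; rewrite sub0set; apply/indepP=> e _.
  by rewrite subset0 => /eqP->; rewrite cards0.
case/existsP=> J0 hJ0.
case: (@arg_maxnP _ J0 (fun J : {set T} => (J \subset Y) && indep J)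
         (fun J => #|J|) hJ0) => J.
case/andP=> JY /indepP iJ maxJ.
have [jJ|Jj] := leqP j #|J|; first by left; exists J.
pose edge y := odflt set0 [pick e in E | (e \subset y |: J) && (1 < #|e|)].
have edgeP y : y \in Y :\: J -> [/\ edge y \in E, edge y \subset y |: J & 1 < #|edge y|].
  rewrite inE => /andP[yJ yY]; rewrite /edge; case: pickP => [e /= /and3P[]//|none].
  have /maxJ : (y |: J \subset Y) && indep (y |: J).
    rewrite subUset sub1set yY JY; apply/indepP=> e Ee eyJ.
    by rewrite leqNgt; have := none e; rewrite /= Ee eyJ /= => ->.
  by rewrite cardsU1 yJ /= add1n ltnn.
have [||A AJ] := @pigeonhole_set _ _ (Y :\: J) (powerset J) (fun y => edge y :&: J) K.
- by move=> y _; rewrite inE subsetIr.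
- rewrite card_powerset cardsD (setIidPr JY) ltn_subRL.
  apply: leq_trans leY; rewrite -addSn; apply: leq_add => //.
  by rewrite leq_mul2r leq_exp2l // (ltnW Jj) orbT.
set Y1 := [set x in _ | _] => ltK.
have Y1P y : y \in Y1 -> [/\ y \in Y, y \notin J & edge y :&: J = A].
  by rewrite !inE => /andP[/andP[-> ->] /eqP].
have Y1Y : Y1 \subset Y by apply/subsetP=> y /Y1P[].
have edge1 y : y \in Y1 -> y \in edge y.
  move=> yY1; have [yY yJ _] := Y1P _ yY1.
  have [|Ee eJ e1] := edgeP y; first by rewrite inE yJ yY.
  rewrite -[_ \in _]negbK; apply/negP => ye; move: e1; rewrite ltnNge iJ //.
  apply/subsetP=> x xe; move/subsetP: eJ => /(_ x xe); rewrite !inE.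
  by case: eqP => [xy|//]; move: xe; rewrite xy (negbTE ye).
have [a aA] : exists a, a \in A.
  have /card_gt0P[y yY1] : 0 < #|Y1| by apply: leq_ltn_trans ltK.
  have [yY yJ yA] := Y1P _ yY1.
  have [|Ee eJ /card_gt1P[x1 [x2 [x1e x2e x12]]]] := edgeP y; first by rewrite inE yJ yY.
  have : exists2 x, x \in edge y & x != y.
    case: (eqVneq x1 y) => [E1|]; last by exists x1.
    by exists x2 => //; rewrite -E1 eq_sym.
  case=> x xe xy; exists x; rewrite -yA inE xe /=.
  by move/subsetP: eJ => /(_ x xe); rewrite !inE (negbTE xy).
have aJ : a \in J by move: AJ; rewrite inE => /subsetP/(_ a aA).
have aY1 : a \notin Y1 by apply/negP=> /Y1P[_]; rewrite aJ.
have [[J1 J1Y h]|[s [ss us sY1 prs]]] := IH T E Y1 (ltnW ltK).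
  by left; exists J1 => //; apply: subset_trans Y1Y.
right; exists (a :: s); split=> /=; first by rewrite ss.
- by rewrite us andbT; apply: contra aY1 => /sY1.
- move=> x; rewrite inE => /orP[/eqP->|/sY1/Y1P[]//]; exact: (subsetP JY).
(* For pairs with [a] the edge of the other point serves: the rest of it lies in [J], away from
   [Y1]. For the other pairs, the member given by induction lies in [Y1] and misses [a]. *)
move=> x0 [|i] [|k] //= ks.
  have kY1 : nth x0 s k \in Y1 by apply/sY1/mem_nth.
  have [kY kJ kA] := Y1P _ kY1.
  have [|Ee eJ _] := edgeP (nth x0 s k); first by rewrite inE kJ kY.
  exists (edge (nth x0 s k)) => //; split.
    by apply: subset_trans eJ _; rewrite subUset sub1set kY JY.
  case=> [|l] /= ls; first by move: aA; rewrite -kA inE => /andP[].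
  rewrite eqSS; case: eqP => [->|/eqP lk]; first exact: edge1.
  apply/negbTE/negP=> /(subsetP eJ); rewrite !inE nth_uniq // (negbTE lk) /=.
  by have /sY1/Y1P[_ /negbTE->] := mem_nth x0 ls.
have [e Ee [eY1 he]] := prs x0 i k ks.
exists e => //; split; first exact: subset_trans Y1Y.
case=> [|l] /= ls; last exact: he.
by apply/negbTE/negP=> /(subsetP eY1); apply/negP.
Qed.

(** The tail is built over [V :|: Y] before its head [c] is chosen in [Y], so it suits every
    candidate. *)
Lemma antitwin_free_or_good (N r : nat) : exists K : nat,
  forall (T : finType) (F : {set {set T}}) (V : {set T}), set0 \in F ->
  (forall s, size s = N -> ~ triangular F s) ->
  (exists2 Y : {set T}, #|Y| <= K & forall y z, ~ antitwins F (V :|: Y) y z) \/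
  (exists2 s, size s = r & good F V s).
Proof.
elim: r => [|r [K0 IH]].
  by exists 0 => T F V _ _; right; exists [::].
(* The size counts the entries and witnesses of a tail of length [r], and [y0]. *)
have [Kb HKb] := independent_or_pairs (2 * r).+1 N.
exists (Kb + K0) => T F V F0 noTri.
(* Working inside [R] guarantees that the head finally chosen has an antitwin over [V]. *)
pose R := [set y | `[<exists z, antitwins F V y z>]].
have inR (W : {set T}) y z : V \subset W -> antitwins F W y z -> y \in R.
  by move=> VW tw; rewrite inE; apply/asboolP; exists z; apply: antitwins_sub tw.
pose fit (Y : {set T}) := (Y \subset R) && (#|Y| <= Kb).
have fit0 : fit set0 by rewrite /fit sub0set cards0.
case: (@arg_minnP _ set0 fit (fun Y : {set T} => #|vanishing F (V :|: Y)|) fit0) => Y.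
case/andP=> YR YKb minY.
have min (Y' : {set T}) : Y' \subset R -> #|Y'| <= Kb ->
    #|vanishing F (V :|: Y)| <= #|vanishing F (V :|: Y')|.
  by move=> Y'R Y'K; apply: minY; rewrite /fit Y'R.
have [[y0 [z0 tw0]]|none] := pselect (exists y z, antitwins F (V :|: Y) y z); last first.
  left; exists Y; first exact: leq_trans YKb (leq_addr _ _).
  by move=> y z tw; apply: none; exists y, z.
have y0R : y0 \in R by apply: inR tw0; apply: subsetUl.
have [f0 Ff0 [f0VY y0f0]] := antitwins_open F0 tw0.
have {}f0VY : [disjoint f0 & V :|: Y] by rewrite -setI_eq0 f0VY.
(* A smaller [Y] could be enlarged by [y0], contradicting minimality. *)
have cY : Kb <= #|Y|.
  rewrite leqNgt; apply/negP=> lt.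
  apply: (@minimal_swap _ F V R Y set0 [set y0] Kb y0 f0 min);
    rewrite ?sub0set ?sub1set ?set11 //.
    by rewrite setD0 cards1 addn1.
  by move=> g _ _; rewrite -setI_eq0 setI0.
(* Otherwise [c] could be traded for [y0]. *)
have sgY c : c \in Y -> single F c (V :|: Y).
  move=> cY1; apply: contrapT => nsg.
  have := @few_forced _ F V R Y [set c] [set y0] Kb y0 f0 min YR YKb.
  rewrite !sub1set set11 cY1 y0R cards1 ltnS leqn0 cards_eq0.
  have ic (g : {set T}) : #|g :&: [set c]| <= 1.
    by apply: leq_trans (subset_leq_card (subsetIr _ _)) _; rewrite cards1.
  move/(_ isT isT (fun g _ _ _ => ic g) isT Ff0 y0f0 f0VY).
  move=> /eqP/setP/(_ c); rewrite !inE eqxx /= => /negbFE/asboolP sg.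
  by apply: nsg; apply: single_sub sg; apply: subsetUl.
(* Edges are the traces on [Y] of members vanishing on [V]. The second alternative, together with
   [sgY], yields a triangular sequence of length [N]. *)
have [[J JY [cJ iJ]]|[s [ss us sY prs]]] :=
    HKb T [set f :&: Y | f in vanishing F V] Y cY; last first.
  case: (noTri s ss); split=> x0 i.
    move=> si; have iY : nth x0 s i \in Y by apply/sY/mem_nth.
    have [f Ff /setP fc] := sgY _ iY; exists f => // k ks.
    have kY : nth x0 s k \in Y by apply/sY/mem_nth.
    by move: (fc (nth x0 s k)); rewrite !inE kY !orbT andbT nth_uniq.
  move=> j hij; have [_ /imsetP[f + ->] [_ hf]] := prs x0 i j hij.
  rewrite inE => /andP[Ff _]; exists f => // k kj.
  have ks : k < size s by apply: leq_ltn_trans kj _; case/andP: hij.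
  by rewrite -hf // inE (sY _ (mem_nth x0 ks)) andbT.
have [[Y1 cY1 noY1]|[s ss gs]] := IH T F (V :|: Y) F0 noTri.
  left; exists (Y :|: Y1); last by rewrite setUA.
  by apply: leq_trans (leq_add YKb cY1); rewrite cardsU leq_subr.
(* [y0] is included because the exchange needs a point of [Z] hit by a member that vanishes on
   [V :|: Y]. *)
right; pose Z := y0 |: ([set x in unzip1 s] :|: [set x in unzip2 s]).
have twR j : j < size s -> nth y0 (unzip1 s) j \in R /\ nth y0 (unzip2 s) j \in R.
  move=> /(good_antitwins y0 gs) tw.
  split; [apply: inR tw | apply: inR (antitwins_sym tw)]; by rewrite -setUA subsetUl.
have ZR : Z \subset R.
  apply/subsetP=> x; rewrite in_setU1 in_setU.
  by case/or3P=> [/eqP->//||]; rewrite inE => /(nthP y0)[j];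
    rewrite size_map => /twR[? ?] <-.
have cZ : #|Z| <= (2 * r).+1.
  rewrite cardsU1 -add1n; apply: leq_add; first exact: leq_b1.
  apply: leq_trans (leq_of_leqif (leq_card_setU _ _)) _.
  rewrite mul2n -addnn -ss -{1}(size_map fst) -(size_map snd).
  by apply: leq_add; rewrite cardsE card_size.
have y0Z : y0 \in Z by rewrite !inE eqxx.
have iJ' g : g \in F -> [disjoint g & V] -> g :&: Y \subset J -> #|g :&: J| <= 1.
  move=> Fg gV gJ; apply: leq_trans (iJ (g :&: Y) _ gJ).
    by apply: subset_leq_card; apply: setIS.
  by apply/imsetP; exists g => //; rewrite inE Fg.
have few := few_forced min YR YKb JY ZR iJ' y0Z Ff0 y0f0 f0VY.
(* Fewer than [#|Z|] points of [J] are excluded, and [J] has at least that many. *)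
have [c cJ1 sg] : exists2 c, c \in J & single F c (V :|: Y :|: Z).
  apply: contrapT => no; move: few; rewrite ltnNge => /negP; apply.
  apply: leq_trans cZ (leq_trans cJ _); apply: subset_leq_card.
  apply/subsetP=> c cJ1; rewrite inE cJ1; apply/asboolP => sg; apply: no; by exists c.
have cY1 := subsetP JY _ cJ1.
have [zc twc] : exists z, antitwins F V c z.
  by move/subsetP: YR => /(_ c cY1); rewrite inE => /asboolP.
have VcVY : c |: V \subset V :|: Y by rewrite subUset sub1set inE cY1 orbT subsetUl.
exists ((c, zc) :: s); first by rewrite /= ss.
split=> //; last exact: good_sub gs.
  apply: single_sub sg; apply/subsetP=> x; rewrite !inE.
  by case/orP=> ->; rewrite ?orbT.
(* The member flipping only [c] misses the witness of the [j]-th entry, so the entry itself, its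
   antitwin, can flip with the same trace. *)
move=> j js; have tw := good_antitwins c gs js.
have [f Ff /setP fc] := sg.
have zZ : nth c (unzip2 s) j \in Z.
  by rewrite !inE mem_nth ?orbT // size_map.
have zY : nth c (unzip2 s) j != c.
  have := antitwins_notin F0 (antitwins_sym tw); apply: contraNneq => ->.
  by rewrite !inE cY1 orbT.
have zf : nth c (unzip2 s) j \notin f.
  have := fc (nth c (unzip2 s) j).
  by rewrite in_setI in_set1 (negbTE zY) in_setU1 in_setU zZ !orbT andbT => ->.
have [g Fg [/setP gf yg]] := antitwins_flip tw Ff zf.
exists g => //; split=> //; apply/setP=> x; move: (gf x) (fc x).
rewrite !inE; case: (eqVneq x c) => [->|xc] /=.
  by rewrite cY1 !orbT !andbT => ->.
case: (x \in V) => /=; first by rewrite !andbT => ->.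
case xt: (x \in take _ _); last by rewrite andbF.
by rewrite (mem_take xt) !orbT !andbT => ->.
Qed.

Lemma exists_antitwin_free (N : nat) : exists K : nat,
  forall (T : finType) (F : {set {set T}}), set0 \in F ->
  (forall s, size s = N -> ~ triangular F s) ->
  exists2 Y : {set T}, #|Y| <= K & forall y z, ~ antitwins F Y y z.
Proof.
have [K HK] := antitwin_free_or_good N N; exists K => T F F0 noTri.
have [[Y cY hY]|[s ss gs]] := HK T F set0 F0 noTri.
  by exists Y => // y z; have := hY y z; rewrite set0U.
by case: (noTri (unzip1 s)); [rewrite size_map | apply: good_triangular gs].
Qed.

(** * Counting the traces of a triangular sequence *)

Lemma card_le2_sets (N : nat) :
  #|[set A : {set 'I_N} | #|A| <= 2]| = ((N * (N + 1)) %/ 2).+1.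
Proof.
have -> : #|[set A : {set 'I_N} | #|A| <= 2]| = \sum_(k < 3) 'C(N, k).
  rewrite -sum1_card (partition_big (fun A : {set 'I_N} => inord #|A| : 'I_3) predT) //.
  apply: eq_bigr => k _; rewrite -[in RHS](card_ord N) -card_draws -sum1_card.
  apply: eq_bigl => A; rewrite !inE; have [A2|A2] := leqP #|A| 2.
    by rewrite -val_eqE /= inordK.
  by apply/esym/negbTE; rewrite neq_ltn orbC (leq_trans (ltn_ord k) A2).
rewrite !big_ord_recr big_ord0 /= bin0 bin1 !add0n add1n addSn; congr _.+1.
by rewrite addn1 mulnC divn2 -(bin2 N.+1) binS bin1 addnC.
Qed.

(** The at most two smallest elements of [t]; later elements, undetermined in [triangular], are cut
    off. *)
Definition first2 (N : nat) (t : {set 'I_N}) :=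
  [set k in t | #|[set l in t | l < k]| < 2].

Lemma first2_pair (N : nat) (t : {set 'I_N}) (i j : 'I_N) : i < j ->
  (forall k : 'I_N, k <= j -> (k \in t) = (k == i) || (k == j)) ->
  first2 t = [set i; j].
Proof.
move=> ij ht; have it : i \in t by rewrite ht ?eqxx // ltnW.
have jt : j \in t by rewrite ht // eqxx orbT.
apply/setP=> k; rewrite !inE; have [kj|jk] := leqP k j.
  rewrite ht //; case: orP => //= kij.
  rewrite ltnS -(cards1 i); apply: subset_leq_card; apply/subsetP=> l.
  rewrite !inE => /andP[lt lk]; have lj : l < j by apply: leq_trans lk kj.
  by move: lt; rewrite ht 1?ltnW // -!val_eqE /= (ltn_eqF lj) orbF.
have -> : (k == i) || (k == j) = false.
  by rewrite -!val_eqE /= (gtn_eqF jk) (gtn_eqF (ltn_trans ij jk)).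
apply/negbTE; rewrite negb_and -leqNgt; apply/orP; right.
have <- : #|[set i; j]| = 2 by rewrite cards2 -val_eqE /= (ltn_eqF ij).
apply: subset_leq_card; apply/subsetP=> l; rewrite !inE.
by case/orP=> /eqP->; rewrite ?it ?jt ?(ltn_trans ij jk).
Qed.

(** [first2] maps the traces onto all sets of at most two indices. *)
Lemma triangular_traces (T : finType) (F : {set {set T}}) (N : nat) (s : N.-tuple T) :
  set0 \in F -> triangular F s ->
  (N * (N + 1)) %/ 2 < #|[set [set k | tnth s k \in f] | f : {set T} in F]|.
Proof.
move=> F0 [sg pr]; rewrite -card_le2_sets; set X := [set _ | _ in F].
apply: leq_trans (leq_imset_card (@first2 N) (mem X)); apply: subset_leq_card.
apply/subsetP=> A; rewrite inE leq_eqVlt ltnS leq_eqVlt ltnS leqn0 cards_eq0.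
case/or3P=> [/cards2P[i [j [ij ->]]]|/cards1P[i ->]|/eqP->].
- wlog lij : i j ij / i < j.
    move=> H; have [/(H _ _ ij)//|ji|/val_inj E] := ltngtP i j.
      by rewrite setUC; apply: H ji; rewrite eq_sym.
    by rewrite E eqxx in ij.
  have [|f Ff hf] := pr (tnth s i) i j; first by rewrite lij size_tuple ltn_ord.
  apply/imsetP; exists [set k | tnth s k \in f]; first exact: imset_f.
  apply/esym/first2_pair => // k kj.
  by rewrite inE (tnth_nth (tnth s i)) hf.
- have [|f Ff hf] := sg (tnth s i) i; first by rewrite size_tuple ltn_ord.
  apply/imsetP; exists [set k | tnth s k \in f]; first exact: imset_f.
  have -> : [set k | tnth s k \in f] = [set i].
    by apply/setP=> k; rewrite !inE (tnth_nth (tnth s i)) hf // size_tuple.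
  apply/setP=> k; rewrite !inE; case: eqP => //= ->; apply/esym.
  rewrite ltnS -(cards1 i); apply: subset_leq_card.
  by apply/subsetP=> l; rewrite !inE => /andP[].
- apply/imsetP; exists [set k | tnth s k \in set0]; first exact: imset_f.
  by apply/setP=> k; rewrite !inE.
Qed.

End Blocks.

(** * Definability of semantic predicates *)

Section Definability.
Variable L : language.
Implicit Types (V W : Type) (M D : structure L).

Lemma eval_rename V W M (s : V -> W) (t : term L V) (v : W -> M) :
  eval v (rename_term s t) = eval (v \o s) t.
Proof.
elim: t => //= r f ts IH; congr func_interp; apply: eq_from_tnth => i.
by rewrite !tnth_mktuple IH.
Qed.

Lemma sat_rename V W M (s : V -> W) (chi : formula L V) (v : W -> M) :
  sat (rename s chi) v <-> sat chi (v \o s).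
Proof.
elim: chi W s v => {V} /= [V t u|V r P ts|V chi IH|V chi IH1 chi' IH2|V chi IH] W s v.
- by rewrite !eval_rename.
- have -> // : [tuple eval v (rename_term s (ts i)) | i < r] =
    [tuple eval (v \o s) (ts i) | i < r].
  by apply: eq_from_tnth => i; rewrite !tnth_mktuple eval_rename.
- by rewrite IH.
- by rewrite IH1 IH2.
- have E a : oapp v a \o omap s = oapp (v \o s) a by apply/funext; case.
  by split=> -[a h]; exists a; move: h; rewrite IH E.
Qed.

(** One formula must work in all structures, so that it can be moved along elementary embeddings. *)
Definition definable V (P : forall M, (V -> M) -> Prop) : Prop :=
  exists chi : formula L V, forall M (v : V -> M), sat chi v <-> P M v.

Lemma definable_ext V (P Q : forall M, (V -> M) -> Prop) :
  (forall M v, P M v <-> Q M v) -> definable P -> definable Q.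
Proof. by move=> PQ [chi h]; exists chi => M v; rewrite h. Qed.

Lemma definable_sat V (chi : formula L V) : definable (fun M v => sat chi v).
Proof. by exists chi. Qed.

Lemma definable_rename V W (s : V -> W) (P : forall M, (V -> M) -> Prop) :
  definable P -> definable (fun M v => P M (v \o s)).
Proof. by move=> [chi h]; exists (rename s chi) => M v; rewrite sat_rename. Qed.

Lemma definable_eq V (x y : V) : definable (fun M v => v x = v y).
Proof. by exists (Eq (Var L x) (Var L y)). Qed.

Lemma definable_not V (P : forall M, (V -> M) -> Prop) :
  definable P -> definable (fun M v => ~ P M v).
Proof. by move=> [chi h]; exists (Not chi) => M v /=; rewrite h. Qed.

Lemma definable_and V (P Q : forall M, (V -> M) -> Prop) :
  definable P -> definable Q -> definable (fun M v => P M v /\ Q M v).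
Proof. by move=> [c h] [c' h']; exists (And c c') => M v /=; rewrite h h'. Qed.

Lemma definable_ex V (P : forall M, (option V -> M) -> Prop) :
  definable P -> definable (fun M v => exists a : M, P M (oapp v a)).
Proof.
move=> [chi h]; exists (Ex chi) => M v /=.
by split=> -[a /h]; exists a => //; apply/h.
Qed.

Lemma definable_True V : definable (fun M (v : V -> M) => True).
Proof.
exists (Ex (Eq (Var L None) (Var L None))) => M v; split=> // _.
by have [a] := carrier_inhabited M; exists a.
Qed.

Lemma definable_bool V (b : bool) : definable (fun M (v : V -> M) => b).
Proof.
case: b; first by apply: definable_ext (definable_True V).
by apply: definable_ext (definable_not (definable_True V)) => M v; split.
Qed.

Lemma definable_imp V (P Q : forall M, (V -> M) -> Prop) :
  definable P -> definable Q -> definable (fun M v => P M v -> Q M v).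
Proof.
move=> dP /definable_not dQ; apply: definable_ext (definable_not (definable_and dP dQ)).
move=> M v; split=> [h p|h [p nq]]; last exact: nq (h p).
by apply: contrapT => nq; apply: h.
Qed.

Lemma definable_iff V (P Q : forall M, (V -> M) -> Prop) :
  definable P -> definable Q -> definable (fun M v => P M v <-> Q M v).
Proof. by move=> dP dQ; apply: definable_and; apply: definable_imp. Qed.

Lemma definable_forall_fin (I : finType) V (P : I -> forall M, (V -> M) -> Prop) :
  (forall i, definable (P i)) -> definable (fun M v => forall i, P i M v).
Proof.
move=> dP; suff: definable (fun M v => forall i, i \in enum I -> P i M v).
  by apply: definable_ext => M v; split=> h i //; apply: h; rewrite mem_enum.
elim: (enum I) => [|i s IH]; first by apply: definable_ext (definable_True V).
apply: definable_ext (definable_and (dP i) IH) => M v; split.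
  by move=> [Pi h] j; rewrite inE => /predU1P[->|/h].
by move=> h; split=> [|j js]; apply: h; rewrite inE ?eqxx // js orbT.
Qed.

Lemma definable_exists_fin (I : finType) V (P : I -> forall M, (V -> M) -> Prop) :
  (forall i, definable (P i)) -> definable (fun M v => exists i, P i M v).
Proof.
move=> dP; apply: definable_ext (definable_not (definable_forall_fin
  (fun i => definable_not (dP i)))) => M v; split=> [h|[i Pi] /(_ i)//].
by apply: contrapT => h'; apply: h => i Pi; apply: h'; exists i.
Qed.

(** Quantifiers bind one variable at a time: [ord0] becomes [None], and induction treats the
    rest. *)
Lemma definable_ex_tuple (m : nat) W (P : forall M, ('I_m + W -> M) -> Prop) :
  definable P -> definable (fun M v => exists a : 'I_m -> M, P M (join a v)).
Proof.
elim: m W P => [|m IH] W P dP.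
  pose s (x : 'I_0 + W) : W :=
    match x with inl i => match notF (valP i) with end | inr w => w end.
  apply: definable_ext (definable_rename s dP) => M v.
  have E a : v \o s = join a v by apply/funext=> -[[]|].
  by split=> [h|[a]]; [exists (fun i => v (s (inl i))); rewrite -E | rewrite -E].
pose s (x : 'I_m.+1 + W) : 'I_m + option W :=
  match x with
  | inl i => if unlift ord0 i is Some j then inl j else inr None
  | inr w => inr (Some w)
  end.
apply: definable_ext (definable_ex (IH _ _ (definable_rename s dP))) => M v.
split=> [[x [a h]]|[a h]].
  exists (fun i => if unlift ord0 i is Some j then a j else x).
  congr (P M _): h; apply/funext=> -[i|w] //=; by case: unliftP.
exists (a ord0), (fun j => a (lift ord0 j)).
congr (P M _): h; apply/funext=> -[i|w] //=; by case: unliftP => [j|] ->.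
Qed.

(** [elementary_embedding] speaks of variables in ['I_r]; an enumeration carries a finite [I]
    there. *)
Lemma elementary_definable (I : finType) M D (e : M -> D)
    (P : forall M, (I -> M) -> Prop) (v : I -> M) :
  elementary_embedding e -> definable P -> P M v <-> P D (e \o v).
Proof.
move=> ee [chi h]; rewrite -!h.
have E (X : structure L) (w : I -> X) : (w \o enum_val) \o enum_rank = w.
  by apply/funext=> i /=; rewrite enum_rankK.
have := ee _ (rename (@enum_rank I) chi) (v \o enum_val).
by rewrite !sat_rename E -[e \o _]/((e \o v) \o enum_val) E.
Qed.

End Definability.

(** * Realization and number of phi-types *)

Local Open Scope classical_set_scope.
Local Open Scope card_scope.
Lemma finite_set_enum (X : Type) (B : set X) : finite_set B ->
  exists (q : nat) (b : 'I_q -> X),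
    injective b /\ forall x, B x <-> exists i, x = b i.
Proof.
move=> /finite_setP[q]; rewrite card_eq_sym => /card_bijP[f [g fK gK]].
exists q, (fun i : 'I_q => val (f (SigSub (mem_set (ltn_ord i : `I_q i))))); split.
  by move=> i j /val_inj/(can_inj fK)/(congr1 val)/= /val_inj.
move=> x; split=> [Bx|[i ->]]; last exact: set_valP.
have qx : (val (g (SigSub (mem_set Bx))) < q)%N by apply: (set_valP (g _)).
exists (Ordinal qx); set u := g _ in qx *.
have -> : SigSub (mem_set (ltn_ord (Ordinal qx) : `I_q (Ordinal qx))) = u by apply: val_inj.
by rewrite gK.
Qed.

Section Realizations.
Variables (L : language) (C : structure L) (m n : nat).
Variable phi : formula L ('I_m + 'I_n).
Implicit Types (B : set (n.-tuple C)) (p : set (formula L ('I_m + C))).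

Lemma sat_phi_at (D : structure L) (e : C -> D) (a : 'I_m -> D) (b : n.-tuple C) :
  sat (phi_at phi b) (join a e) <-> sat phi (join a (e \o tnth b)).
Proof.
rewrite sat_rename; have -> // : join a e \o join inl (inr \o tnth b) = join a (e \o tnth b).
by apply/funext; case.
Qed.

Definition type_of B (a : 'I_m -> C) : set (formula L ('I_m + C)) :=
  [set chi | phi_formulas phi B chi /\ sat chi (join a id)].

Lemma type_of_phi_at B a b : B b ->
  type_of B a (phi_at phi b) <-> sat phi (join a (tnth b)).
Proof.
move=> Bb; rewrite -(sat_phi_at id); split=> [[]//|h]; split=> //.
by exists b; split=> //; left.
Qed.

(** For maximality: a formula of [q] false at [a] has its opposite in the type of [a], hence in [q],
    which is consistent. *)
Lemma phi_types_type_of B a : phi_types phi B (type_of B a).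
Proof.
split=> [chi []//||q qB [D [e [d [ee dq]]]] tq].
  by exists C, id, a; split=> // chi [].
apply/seteqP; split=> // chi qchi; split; first exact: qB.
apply: contrapT => nchi; have [b [Bb [E|E]]] := qB _ qchi.
  have /tq/dq : type_of B a (Not chi).
    by split=> //; exists b; split=> //; right; rewrite E.
  by apply; apply: dq.
have sb : sat (phi_at phi b) (join a id).
  by apply: contrapT => nb; apply: nchi; rewrite E.
have /tq/dq : type_of B a (phi_at phi b) by split=> //; exists b; split=> //; left.
by have := dq _ qchi; rewrite E.
Qed.

(** [p] is realized in an elementary extension. That some tuple has its truth pattern at the [b i]
    is a formula in the [b i], so it transfers to [C]. *)
Lemma phi_types_realized (q : nat) (b : 'I_q -> n.-tuple C) B p :
  (forall i, B (b i)) -> phi_types phi B p ->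
  exists a : 'I_m -> C,
    forall i, p (phi_at phi (b i)) <-> sat phi (join a (tnth (b i))).
Proof.
move=> Bb [pB [D [e [d [ee dp]]]] maxp].
have pd i : p (phi_at phi (b i)) <-> sat phi (join d (e \o tnth (b i))).
  rewrite -sat_phi_at; split=> [/dp//|sd].
  (* By maximality [p] contains all phi-formulas over [B] that hold at [d]. *)
  pose r := [set chi | phi_formulas phi B chi /\ sat chi (join d e)].
  have <- : r = p.
    apply: maxp => [chi []//||chi pchi]; first by exists D, e, d; split=> // chi [].
    by split; [apply: pB | apply: dp].
  by split=> //; exists (b i); split=> //; left.
pose P (M : structure L) (v : 'I_q * 'I_n -> M) := exists a : 'I_m -> M,
  forall i, (`[<p (phi_at phi (b i))>] : Prop) <-> sat phi (join a (fun l => v (i, l))).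
have dP : definable P.
  apply: (@definable_ex_tuple L m _ (fun M w => forall i,
    (`[<p (phi_at phi (b i))>] : Prop) <->
    sat phi (join (w \o inl) (fun l => w (inr (i, l)))))).
  apply: definable_forall_fin => i; apply: definable_iff; first exact: definable_bool.
  pose s (x : 'I_m + 'I_n) : 'I_m + 'I_q * 'I_n :=
    match x with inl j => inl j | inr l => inr (i, l) end.
  apply: definable_ext (definable_rename s (definable_sat phi)) => M w.
  by have -> : w \o s = join (w \o inl) (fun l => w (inr (i, l))) by apply/funext; case.
have [_] := elementary_definable (fun x => tnth (b x.1) x.2) ee dP.
case=> [|a ha]; first by exists d => i; rewrite asboolE; apply: pd.
by exists a => i; rewrite -ha asboolE.
Qed.

End Realizations.

Lemma card_range_ord (X : Type) (q : nat) (f : 'I_q -> X) :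
  injective f -> range f #= `I_q.
Proof.
move=> fI; apply: card_eq_trans (inj_card_eq (in2W fI)) _.
have <- : range (val : 'I_q -> nat) = `I_q.
  by apply/seteqP; split=> [_ [i _ <-]|i iq] /=; [exact: ltn_ord|exists (Ordinal iq)].
by rewrite card_eq_sym; apply: inj_card_eq; apply: in2W val_inj.
Qed.

(** The twist by [sgn] is fixed, so different sets come from different types over the range of
    [w]. *)
Lemma card_traces_le (L : language) (C : structure L) (m n N : nat)
    (phi : formula L ('I_m + 'I_n)) (k : nat) (w : 'I_N -> n.-tuple C)
    (sgn : 'I_N -> bool) (X : {set {set 'I_N}}) :
  (forall B : set (n.-tuple C), B #= `I_N -> phi_types phi B #<= `I_k) ->
  injective w ->
  (forall A, A \in X -> exists a : 'I_m -> C,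
     forall i, (i \in A) = `[<sat phi (join a (tnth (w i)))>] (+) sgn i) ->
  (#|X| <= k)%N.
Proof.
move=> hphi wI hX.
have hX' (A : {set 'I_N}) : exists a : 'I_m -> C, A \in X ->
    forall i, (i \in A) = `[<sat phi (join a (tnth (w i)))>] (+) sgn i.
  have [/hX[a h]|_] := boolP (A \in X); first by exists a.
  by have [x] := carrier_inhabited C; exists (fun _ => x).
have [a_ ha] := choice hX'.
pose g (i : 'I_#|X|) := type_of phi (range w) (a_ (enum_val i)).
have gI : injective g.
  move=> i j gij; apply: enum_val_inj; apply/setP=> l.
  rewrite !ha ?enum_valP //; congr (_ (+) _); apply: asbool_equiv_eq.
  have wl : range w (w l) by exists l.
  by rewrite -!(type_of_phi_at phi _ wl) -/(g i) gij.
rewrite -card_le_II; apply: card_le_trans (hphi _ (card_range_ord wI)).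
have := card_range_ord gI; rewrite card_eq_sym => /card_eqPle[+ _].
move=> /card_le_trans; apply; apply: subset_card_le => _ [i _ <-].
exact: phi_types_type_of.
Qed.

(** * The defining formula *)

Section Decoder.
Variables (L : language) (m n : nat) (phi : formula L ('I_m + 'I_n)) (K : nat).

Notation profile_type := {set {ffun 'I_K -> bool} * bool}.

Definition profile (M : structure L) (z : 'I_K -> 'I_n -> M) (y : 'I_n -> M) :
    profile_type :=
  [set x : {ffun 'I_K -> bool} * bool | `[<exists a : 'I_m -> M,
     (forall j, sat phi (join a (z j)) <-> x.1 j) /\
     (sat phi (join a y) <-> x.2)>]]%SET.

(* Besides the parameters z_j, one parameter for every profile Q and a reference
   parameter: Q is decoded as true iff its parameter equals the reference. *)
Notation par := ('I_K + option profile_type)%type.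

Definition decoder (M : structure L) (v : 'I_n + 'I_#|{: par}| * 'I_n -> M) : Prop :=
  exists Q : profile_type,
    (forall l, v (inr (enum_rank (inr (Some Q) : par), l)) =
               v (inr (enum_rank (inr None : par), l))) /\
    profile (fun j l => v (inr (enum_rank (inl j : par), l))) (v \o inl) = Q.

(** A finite disjunction over [Q]; that the profile equals [Q] is a finite conjunction over the
    possible members [x]. *)
Lemma definable_decoder : definable decoder.
Proof.
apply: definable_exists_fin => Q; apply: definable_and.
  by apply: definable_forall_fin => l; apply: definable_eq.
pose P (x : {ffun 'I_K -> bool} * bool) (M : structure L)
    (v : 'I_n + 'I_#|{: par}| * 'I_n -> M) :=
  exists a : 'I_m -> M,
    (forall j, sat phi (join a (fun l => v (inr (enum_rank (inl j : par), l)))) <->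
       x.1 j) /\
    (sat phi (join a (v \o inl)) <-> x.2).
suff dP x : definable (P x).
  apply: (@definable_ext _ _ (fun M v => forall x, (x \in Q : Prop) <-> P x M v)).
    move=> M v; split=> [h|<- x]; last by rewrite inE asboolE.
    by apply/setP=> x; rewrite inE; apply/asboolP/idP; rewrite -/(P x M v) -h.
  by apply: definable_forall_fin => x; apply: definable_iff => //; apply: definable_bool.
apply: (@definable_ex_tuple _ _ _ (fun M w =>
  (forall j, sat phi (join (w \o inl)
     (fun l => w (inr (inr (enum_rank (inl j : par), l))))) <-> x.1 j) /\
  (sat phi (join (w \o inl) (w \o inr \o inl)) <-> x.2))).
have dsat (s : 'I_n -> 'I_n + 'I_#|{: par}| * 'I_n) :
    @definable L ('I_m + ('I_n + 'I_#|{: par}| * 'I_n)) (fun M w =>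
      sat phi (join (w \o inl) (w \o inr \o s))).
  pose t (u : 'I_m + 'I_n) :=
    match u with inl j => inl j | inr l => inr (s l) end.
  apply: definable_ext (definable_rename t (definable_sat phi)) => M w.
  by have -> : w \o t = join (w \o inl) (w \o inr \o s) by apply/funext; case.
apply: definable_and; last by apply: definable_iff; [exact: dsat | exact: definable_bool].
apply: definable_forall_fin => j; apply: definable_iff; last exact: definable_bool.
exact: (dsat (fun l => inr (enum_rank (inl j : par), l))).
Qed.

End Decoder.

(** * Flips with respect to a type *)

Section FlipFamily.
Variables (L : language) (C : structure L) (m n : nat).
Variables (phi : formula L ('I_m + 'I_n)) (q : nat) (b : 'I_q -> n.-tuple C).
Variable sgn : 'I_q -> bool.

Definition flips : {set {set 'I_q}} :=
  [set f : {set 'I_q} | `[<exists a : 'I_m -> C, forall i,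
     (i \in f) = `[<sat phi (join a (tnth (b i)))>] (+) sgn i>]]%SET.

Lemma flipsP (f : {set 'I_q}) : reflect (exists a : 'I_m -> C, forall i,
  (i \in f) = `[<sat phi (join a (tnth (b i)))>] (+) sgn i) (f \in flips).
Proof. by rewrite inE; apply: asboolP. Qed.

(** Entries of a triangular sequence of length [N] index distinct tuples, and their traces would
    give too many types over these. *)
Lemma flips_no_triangular (N : nat) :
  (forall B : set (n.-tuple C), B #= `I_N ->
     phi_types phi B #<= `I_((N * (N + 1)) %/ 2)) ->
  injective b -> finset.set0 \in flips ->
  forall s, size s = N -> ~ triangular flips s.
Proof.
move=> hphi bI F0 s /eqP ss tri; pose t := Tuple ss.
have := triangular_traces (s := t) F0 tri; rewrite ltnNge => /negP; apply.
apply: (card_traces_le (w := b \o tnth t) (sgn := sgn \o tnth t) hphi).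
  apply: inj_comp bI _ => i j /= tij; apply/eqP.
  have [|f _ hf] := tri.1 (tnth t i) i; first by rewrite (eqP ss) ltn_ord.
  have ti : tnth t i \in f by rewrite (tnth_nth (tnth t i)) hf ?eqxx // (eqP ss).
  by move: ti; rewrite tij (tnth_nth (tnth t i)) hf ?(eqP ss) // eq_sym.
move=> A /imsetP[f /flipsP[a ha] ->]; exists a => i.
by rewrite inE ha.
Qed.

(** A pattern and value shown at [b i] by some tuple are shown at [b j] by another; opposite signs
    turn equal values into opposite flips. *)
Lemma profile_eq_antitwins (K : nat) (c : 'I_K -> 'I_q) (i j : 'I_q) :
  profile phi (fun k => tnth (b (c k))) (tnth (b i)) =
  profile phi (fun k => tnth (b (c k))) (tnth (b j)) ->
  sgn i != sgn j -> antitwins flips [set c k | k : 'I_K]%SET i j.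
Proof.
suff half i' j' h e :
    profile phi (fun k => tnth (b (c k))) (tnth (b i')) =
    profile phi (fun k => tnth (b (c k))) (tnth (b j')) -> sgn i' != sgn j' ->
    (exists2 f, f \in flips &
       f :&: [set c k | k : 'I_K]%SET = h /\ (i' \in f) = e) ->
    (exists2 f, f \in flips &
       f :&: [set c k | k : 'I_K]%SET = h /\ (j' \in f) = ~~ e).
  move=> eq_pr neq h e; split; first exact: half.
  by rewrite -{2}[e]negbK; apply: half; rewrite // eq_sym.
move=> /setP eq_pr neq [f /flipsP[a ha] [<- <-]].
pose x := ([ffun k => `[<sat phi (join a (tnth (b (c k))))>]],
           `[<sat phi (join a (tnth (b i')))>]) : {ffun 'I_K -> bool} * bool.
have : x \in profile phi (fun k => tnth (b (c k))) (tnth (b i')).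
  rewrite inE; apply/asboolP; exists a; split=> [k|]; rewrite ?ffunE asboolE //.
rewrite eq_pr inE => /asboolP[a' [ac aj]].
exists [set l | `[<sat phi (join a' (tnth (b l)))>] (+) sgn l]%SET.
  by apply/flipsP; exists a' => l; rewrite inE.
split.
  apply/setP=> l; rewrite !inE; case: imsetP => [[k _ ->]|]; last by rewrite !andbF.
  rewrite !andbT ha; congr (_ (+) _); apply: asbool_equiv_eq.
  by rewrite ac ffunE asboolE.
rewrite inE ha.
have -> : `[<sat phi (join a' (tnth (b j')))>] = `[<sat phi (join a (tnth (b i')))>].
  by apply: asbool_equiv_eq; rewrite aj asboolE.
by move: neq; case: (sgn i'); case: (sgn j'); case: `[<_>].
Qed.

End FlipFamily.

(** * Choice of the parameters for a given type *)

Theorem theorem3p14 (L : language) (T : set (sentence L)) (kappa : Type)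
    (C : structure L) (hT : complete_theory T)
    (hC : monster_model kappa T C) (m n : nat)
    (phi : formula L ('I_m + 'I_n)) (N : nat) (hN : (0 < N)%N)
    (hphi : forall B : set (n.-tuple C), B #= `I_N ->
       phi_types phi B #<= `I_((N * (N + 1)) %/ 2)) :
  UDTFS C phi.
Proof.
have [K HK] := exists_antitwin_free N.
have [psi hpsi] := definable_decoder phi K.
exists _, psi => B finB B2 p pB.
have [q [b [bI Bb]]] := finite_set_enum finB.
have Bbi i : B (b i) by apply/Bb; exists i.
have [i0 [i1 i01]] : exists i0 i1 : 'I_q, i0 != i1.
  have : (2 <= q)%N.
    rewrite -card_le_II; apply: card_le_trans B2 _.
    have <- : range b = B.
      by apply/seteqP; split=> [_ [i _ <-]//|x /Bb[i ->]]; exists i.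
    by have /card_eqPle[] := card_range_ord bI.
  by case: q b bI Bb Bbi => [|[|q]] // *; exists ord0, ord_max.
pose sgn i := `[<p (phi_at phi (b i))>].
(* A tuple realizing [p] on all the [b i] has no disagreement with it. *)
have F0 : finset.set0 \in flips phi b sgn.
  have [a ha] := phi_types_realized Bbi pB.
  apply/flipsP; exists a => i; rewrite inE /sgn.
  by rewrite (asbool_equiv_eq (ha i)) addbb.
have [Y cY noY] := HK _ _ F0 (flips_no_triangular hphi bI F0).
(* [Y] may have fewer than [K] points; the list is padded with [i0]. *)
pose c (k : 'I_K) := nth i0 (enum Y) k.
have Yc : Y \subset [set c k | k : 'I_K]%SET.
  apply/fintype.subsetP=> y; rewrite -mem_enum => /(nthP i0)[k ks <-].
  rewrite -cardE in ks; have kK := leq_trans ks cY.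
  by apply/imsetP; exists (Ordinal kK).
pose pr i := profile phi (fun k => tnth (b (c k))) (tnth (b i)).
have sgn_pr i j : pr i = pr j -> sgn i = sgn j.
  move=> E; apply/eqP; apply: contrapT => /negP neq.
  by apply: (noY i j); apply: antitwins_sub Yc (profile_eq_antitwins E neq).
(* The common truth value of the elements with profile [Q], false for profiles that do not occur. *)
pose delta Q := [exists i, (pr i == Q) && sgn i].
pose par : 'I_K + option {set {ffun 'I_K -> bool} * bool} -> n.-tuple C :=
  fun x => match x with
  | inl k => b (c k)
  | inr None => b i0
  | inr (Some Q) => if delta Q then b i0 else b i1
  end.
exists (par \o enum_val); split.
  by move=> j; rewrite /= /par; case: (enum_val j) => [k|[Q|]] //; case: ifP.
move=> x /Bb[i ->]; rewrite hpsi /decoder /=.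
have -> : p (phi_at phi (b i)) <-> delta (pr i).
  rewrite -[p _]asboolE -/(sgn i); split=> [si|/existsP[j /andP[/eqP/sgn_pr <-]]//].
  by apply/existsP; exists i; rewrite eqxx.
have zE : (fun (k : 'I_K) l => tnth (par (enum_val (enum_rank
    (inl k : 'I_K + option {set {ffun 'I_K -> bool} * bool})))) l) =
    fun k => tnth (b (c k)).
  by apply/funext=> k; apply/funext=> l; rewrite enum_rankK.
split=> [[Q [eQ]]|dQ]; rewrite ?zE -/(pr i); last first.
  by exists (pr i); split=> [l|]; rewrite ?zE // !enum_rankK /= dQ.
move=> prQ; rewrite -{}prQ in eQ.
(* If [delta] were false at the profile, its parameter would be [b i1], yet equal to the reference
   [b i0]. *)
apply: contrapT => /negP nd; case/eqP: i01; apply: bI; apply: eq_from_tnth => l.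
by have := eQ l; rewrite !enum_rankK /= (negbTE nd).
Qed.
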